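(* Let $K$ be a field of characteristic zero and let $F_n(\mathfrak{N}_3)$ be the relatively free algebra of rank $n$ in the variety $\mathfrak{N}_3$. (i) If $n \geq 4$ is an even integer, then the T-ideal $\mathrm{Id}(F_n(\mathfrak{N}_3))$ of polynomial identities of $F_n(\mathfrak{N}_3)$ is generated (as a T-ideal) by the polynomials $[x_1,x_2,x_3,x_4]$ and $[x_1,x_2][x_3,x_4]\cdots[x_{n+1},x_{n+2}]$. (ii) If $n \geq 5$ is an odd integer, then the T-ideal $\mathrm{Id}(F_n(\mathfrak{N}_3))$ is generated (as a T-ideal) by the polynomials $[x_1,x_2,x_3,x_4]$ and $[x_1,x_2][x_3,x_4]\cdots[x_n,x_{n+1}]$.
   Context: All algebras are associative and unitary over a field $K$ of characteristic zero. $K\langle X\rangle$ is the free unitary associative algebra on $X=\{x_1,x_2,\dots\}$. Commutators are left-normed: $[a,b]=ab-ba$ and $[a_1,\dots,a_{m}]=[[a_1,\dots,a_{m-1}],a_m]$ for $m\ge 3$. $I_p$ is the two-sided ideal of $K\langle X\rangle$ generated by all commutators $[u_1,\dots,u_p]$, $u_i\in K\langle X\rangle$. $\mathfrak{N}_p$ is the variety of algebras satisfying $[x_1,\dots,x_{p+1}]=0$, and $F_n(\mathfrak{N}_p)=K\langle x_1,\dots,x_n\rangle/(I_{p+1}\cap K\langle x_1,\dots,x_n\rangle)$. A polynomial $f(x_1,\dots,x_m)\in K\langle X\rangle$ is an identity of an algebra $A$ if $f(a_1,\dots,a_m)=0$ for all $a_i\in A$; $\mathrm{Id}(A)\subseteq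 K\langle X\rangle$ is the set of identities of $A$. A T-ideal is an ideal of $K\langle X\rangle$ closed under all $K$-algebra endomorphisms of $K\langle X\rangle$; the T-ideal generated by a set is the smallest T-ideal containing it. *)

(* Defs.v *)
From HB Require Import structures.
From mathcomp Require Import all_boot all_order all_algebra.
From mathcomp.classical Require Import boolp.
From mathcomp Require Import monalg.

Set Implicit Arguments.
Unset Strict Implicit.
Unset Printing Implicit Defensive.

Import GRing.Theory.

Local Open Scope ring_scope.
Local Open Scope quotient_scope.

(* K<I>, the monoid algebra over K of the free monoid of words on I.  It is   *)
(* an alias because monalg makes {malg K[M]} an algType only for commutative  *)
(* M, and that declaration prevents one for the free monoid.                  *)
Definition freealg (K : comNzRingType) (I : choiceType) : Type :=
  {malg K[{fmonom I}]}.

Section FreeAlgebra.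
Context (K : comNzRingType) (I : choiceType).

HB.instance Definition _ := GRing.Lalgebra.on (freealg K I).

Fact freealg_scaleAr (k : K) (f g : freealg K I) :
  k *: (f * g) = f * (k *: g).
Proof.
have comm_malgC (h : freealg K I) : (k%:MP : freealg K I) * h = h * k%:MP.
  rewrite malgM_def fgmulUg malgM_def fgmulgU; apply: eq_bigr => m _.
  by rewrite mulrC mulm1 mul1m.
by rewrite -!mul_malgC mulrA [_ * f]comm_malgC mulrA.
Qed.

HB.instance Definition _ :=
  GRing.Lalgebra_isAlgebra.Build K (freealg K I) freealg_scaleAr.

Definition fvar (i : I) : freealg K I := << fmu i >>.

End FreeAlgebra.

(* The value of f at x_i := a i in an arbitrary associative unital algebra A. *)
Section Evaluation.
Context (K : comNzRingType) (I : choiceType) (A : algType K) (a : I -> A).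

Definition word_eval (m : {fmonom I}) : A := \prod_(i <- m) a i.

Definition feval (f : freealg K I) : A := mmap (in_alg A) word_eval f.

Fact word_eval_mmorphism : mmorphism word_eval.
Proof.
split=> [m1 m2|]; first by rewrite /word_eval fmM big_cat.
by rewrite /word_eval fm1 big_nil.
Qed.

HB.instance Definition _ := isMultiplicative.Build {fmonom I} A word_eval
  word_eval_mmorphism.

Fact feval_zmod_morphism : zmod_morphism feval.
Proof. by move=> f g; apply: (@mmap_is_additive _ _ _ (in_alg A)). Qed.

HB.instance Definition _ :=
  GRing.isZmodMorphism.Build (freealg K I) A feval feval_zmod_morphism.

Fact feval_monoid_morphism : monoid_morphism feval.
Proof.
have [|h1 h2] := @commr_mmap_is_multiplicative _ _ _ (in_alg A) word_eval.
  by move=> f m m'; rewrite /GRing.comm /= mulr_algl mulr_algr.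
by split.
Qed.

HB.instance Definition _ :=
  GRing.isMonoidMorphism.Build (freealg K I) A feval feval_monoid_morphism.

Fact feval_scalable : scalable feval.
Proof.
by move=> c f; rewrite /feval (@mmapZ _ _ _ (in_alg A)) /= mulr_algl.
Qed.

HB.instance Definition _ :=
  GRing.isScalable.Build K (freealg K I) A *:%R feval feval_scalable.

End Evaluation.

Section Commutators.
Context {R : nzRingType}.

Definition comm (a b : R) : R := a * b - b * a.

(* Left-normed: lncomm a [:: b1; ...; bk] = [a, b1, ..., bk].                 *)
Definition lncomm (a : R) (s : seq R) : R := foldl comm a s.

Record is_ideal (J : R -> Prop) : Prop := IsIdeal {
  ideal0 : J 0;
  idealD : forall f g, J f -> J g -> J (f + g);
  idealMl : forall h f, J f -> J (h * f);
  idealMr : forall h f, J f -> J (f * h) }.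

Definition ideal_gen (S : R -> Prop) (f : R) : Prop :=
  forall J, is_ideal J -> (forall g, S g -> J g) -> J f.

Lemma ideal_gen_ideal S : is_ideal (ideal_gen S).
Proof.
split=> [J|f g Sf Sg J|h f Sf J|h f Sf J] JI SJ.
- exact: ideal0 JI.
- by apply: (idealD JI); [apply: Sf | apply: Sg].
- by apply: (idealMl JI); apply: Sf.
- by apply: (idealMr JI); apply: Sf.
Qed.

Lemma idealN J f : is_ideal J -> J f -> J (- f).
Proof. by move=> JI Jf; rewrite -mulN1r; apply: (idealMl JI). Qed.

End Commutators.

Section IdealQuotient.
Context (K : nzRingType) (A : algType K) (J : A -> Prop) (JI : is_ideal J).

Definition ideal_equiv (f g : A) : bool := `[< J (f - g) >].

Fact ideal_equiv_is_equiv : equiv_class_of ideal_equiv.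
Proof.
split=> [f|f g|g f h].
- by apply/asboolP; rewrite subrr; apply: ideal0 JI.
- by apply/asboolP/asboolP => fg; rewrite -opprB; apply: idealN.
- move=> /asboolP fg /asboolP gh; apply/asboolP.
  by rewrite -(subrKA g f (- h)); apply: idealD.
Qed.

Canonical ideal_equivRel := EquivRelPack ideal_equiv_is_equiv.

Definition ideal_quot : Type := {eq_quot ideal_equivRel}.

HB.instance Definition _ := Choice.on ideal_quot.
HB.instance Definition _ := EqQuotient.on ideal_quot.

Local Notation pi := (\pi_ideal_quot).

Lemma ideal_quot_eqP f g : pi f = pi g <-> J (f - g).
Proof.
split=> [/eqP|fg]; first by rewrite piE => /asboolP.
by apply/eqP; rewrite piE; apply/asboolP.
Qed.

Lemma ideal_quot_repr f : J (repr (pi f) - f).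
Proof. by apply/ideal_quot_eqP; rewrite reprK. Qed.

(* Locked: each operation unfolds to \pi _, so rewriting with the lemmas     *)
(* quot_*E below would otherwise match inside the operations themselves.      *)
Definition quot_opp := locked (fun x : ideal_quot => pi (- repr x)).
Definition quot_add := locked (fun x y : ideal_quot => pi (repr x + repr y)).
Definition quot_mul := locked (fun x y : ideal_quot => pi (repr x * repr y)).
Definition quot_scale :=
  locked (fun (k : K) (x : ideal_quot) => pi (k *: repr x)).

Lemma quot_oppE f : quot_opp (pi f) = pi (- f).
Proof.
rewrite /quot_opp -lock; apply/ideal_quot_eqP; rewrite -opprD.
apply: idealN => //.
exact: ideal_quot_repr.
Qed.

Lemma quot_addE f g : quot_add (pi f) (pi g) = pi (f + g).
Proof.
rewrite /quot_add -lock; apply/ideal_quot_eqP; rewrite opprD addrACA.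
by apply: idealD => //; apply: ideal_quot_repr.
Qed.

Lemma quot_mulE f g : quot_mul (pi f) (pi g) = pi (f * g).
Proof.
rewrite /quot_mul -lock; apply/ideal_quot_eqP.
rewrite -(subrKA (f * repr (pi g))) -mulrBl -mulrBr.
by apply: idealD => //; [apply: idealMr|apply: idealMl] => //;
  apply: ideal_quot_repr.
Qed.

Lemma quot_scaleE k f : quot_scale k (pi f) = pi (k *: f).
Proof.
rewrite /quot_scale -lock; apply/ideal_quot_eqP; rewrite -scalerBr -mulr_algl.
by apply: idealMl => //; apply: ideal_quot_repr.
Qed.

Let quotE := (quot_oppE, quot_addE, quot_mulE, quot_scaleE).

Fact quot_addA : associative quot_add.
Proof.
by move=> x y z; rewrite -[x]reprK -[y]reprK -[z]reprK !quotE addrA.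
Qed.
Fact quot_addC : commutative quot_add.
Proof. by move=> x y; rewrite -[x]reprK -[y]reprK !quotE addrC. Qed.
Fact quot_add0 : left_id (pi 0) quot_add.
Proof. by move=> x; rewrite -[x]reprK !quotE add0r. Qed.
Fact quot_addN : left_inverse (pi 0) quot_opp quot_add.
Proof. by move=> x; rewrite -[x]reprK !quotE addNr. Qed.

HB.instance Definition _ := GRing.isZmodule.Build ideal_quot
  quot_addA quot_addC quot_add0 quot_addN.

Let quot_addP (x y : ideal_quot) : x + y = quot_add x y. Proof. by []. Qed.

Fact quot_mulA : associative quot_mul.
Proof.
by move=> x y z; rewrite -[x]reprK -[y]reprK -[z]reprK !quotE mulrA.
Qed.
Fact quot_mul1q : left_id (pi 1) quot_mul.
Proof. by move=> x; rewrite -[x]reprK !quotE mul1r. Qed.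
Fact quot_mulq1 : right_id (pi 1) quot_mul.
Proof. by move=> x; rewrite -[x]reprK !quotE mulr1. Qed.
Fact quot_mulDl : left_distributive quot_mul +%R.
Proof.
by move=> x y z; rewrite -[x]reprK -[y]reprK -[z]reprK !quot_addP !quotE mulrDl.
Qed.
Fact quot_mulDr : right_distributive quot_mul +%R.
Proof.
by move=> x y z; rewrite -[x]reprK -[y]reprK -[z]reprK !quot_addP !quotE mulrDr.
Qed.

HB.instance Definition _ := GRing.Zmodule_isPzRing.Build ideal_quot
  quot_mulA quot_mul1q quot_mulq1 quot_mulDl quot_mulDr.

Fact quot_scaleA k l x : quot_scale k (quot_scale l x) = quot_scale (k * l) x.
Proof. by rewrite -[x]reprK !quotE scalerA. Qed.
Fact quot_scale1 : left_id 1 quot_scale.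
Proof. by move=> x; rewrite -[x]reprK !quotE scale1r. Qed.
Fact quot_scaleDr : right_distributive quot_scale +%R.
Proof.
by move=> k x y; rewrite -[x]reprK -[y]reprK !quot_addP !quotE scalerDr.
Qed.
Fact quot_scaleDl x : {morph quot_scale^~ x : k l / k + l}.
Proof.
by move=> k l; rewrite -[x]reprK !quot_addP !quotE scalerDl.
Qed.

HB.instance Definition _ := GRing.Zmodule_isLmodule.Build K ideal_quot
  quot_scaleA quot_scale1 quot_scaleDr quot_scaleDl.

Let quot_mulP (x y : ideal_quot) : x * y = quot_mul x y. Proof. by []. Qed.
Let quot_scaleP k (x : ideal_quot) : k *: x = quot_scale k x.
Proof. by []. Qed.

Fact quot_scaleAl k (x y : ideal_quot) : k *: (x * y) = k *: x * y.
Proof.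
by rewrite -[x]reprK -[y]reprK !(quot_mulP, quot_scaleP) !quotE scalerAl.
Qed.
Fact quot_scaleAr k (x y : ideal_quot) : k *: (x * y) = x * (k *: y).
Proof.
by rewrite -[x]reprK -[y]reprK !(quot_mulP, quot_scaleP) !quotE scalerAr.
Qed.

End IdealQuotient.

Section TIdeals.
Context (K : comNzRingType).

(* K<X>; the variable x_i of X = {x_1, x_2, ...} is fvar K (i - 1).           *)
Local Notation KX := (freealg K nat).

Definition comm_ideal (p : nat) : KX -> Prop :=
  ideal_gen (fun f => exists u s, size (u :: s) = p /\ f = lncomm u s).

Definition is_Tideal (J : KX -> Prop) : Prop :=
  is_ideal J /\ forall (phi : {lrmorphism KX -> KX}) f, J f -> J (phi f).

Definition Tideal_gen (S : KX -> Prop) (f : KX) : Prop :=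
  forall J, is_Tideal J -> (forall g, S g -> J g) -> J f.

(* [x_1, x_2][x_3, x_4]...[x_(2k-1), x_(2k)]                                  *)
Definition comm_prod (k : nat) : KX :=
  \prod_(i < k) comm (fvar K i.*2) (fvar K i.*2.+1).

(* f involves finitely many variables, so substituting for all of X at once   *)
(* amounts to substituting for those.                                         *)
Definition Id (A : algType K) (f : KX) : Prop :=
  forall a : nat -> A, feval a f = 0.

End TIdeals.

Section RelativelyFree.
Context (K : comNzRingType) (n p : nat).

(* The inclusion of K<x_1, ..., x_n> into K<X>.                               *)
Definition free_incl : freealg K 'I_n -> freealg K nat :=
  feval (fun i : 'I_n => fvar K (nat_of_ord i)).

HB.instance Definition _ := GRing.LRMorphism.on free_incl.

(* I_(p+1) :&: K<x_1, ..., x_n>                                               *)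
Definition relfree_ideal (f : freealg K 'I_n) : Prop :=
  comm_ideal p.+1 (free_incl f).

Fact relfree_ideal_is_ideal : is_ideal relfree_ideal.
Proof.
have CI : is_ideal (@comm_ideal K p.+1) by apply: ideal_gen_ideal.
split=> [|f g Jf Jg|h f Jf|h f Jf]; rewrite /relfree_ideal.
- by rewrite (raddf0 free_incl); apply: ideal0 CI.
- by rewrite (raddfD free_incl); exact: (idealD CI Jf Jg).
- by rewrite (rmorphM free_incl); exact: (idealMl CI _ Jf).
- by rewrite (rmorphM free_incl); exact: (idealMr CI _ Jf).
Qed.

(* F_n(N_p)                                                                   *)
Definition relfree : Type := ideal_quot relfree_ideal_is_ideal.

HB.instance Definition _ := GRing.Lmodule.on relfree.
HB.instance Definition _ := GRing.PzRing.on relfree.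

End RelativelyFree.

(* F_n(N_p) is a nonzero ring, as an algType must be, only for p > 0.         *)
Section RelativelyFreeAlgebra.
Context (K : comNzRingType) (n p : nat).

(* The augmentation f |-> f(0, 0, ...) kills commutators of length >= 2.      *)
Fact relfree_oner_neq0 : (1 : relfree K n p.+1) != 0.
Proof.
apply/eqP => /ideal_quot_eqP.
rewrite subr0 /relfree_ideal (rmorph1 (@free_incl K n)).
pose eps := mcoeff (fmone nat) : freealg K nat -> K.
have epsM (f g : freealg K nat) : eps (f * g) = eps f * eps g.
  exact: (rmorphM (@mcoeff {fmonom nat} K mone)).
move=> /(_ (fun f => eps f = 0)) eps1.
have epsB (f g : freealg K nat) : eps (f - g) = eps f - eps g.
  exact: mcoeffB.
suff: eps 1 = 0 by rewrite /eps mcoeff1 eqxx => /eqP; rewrite oner_eq0.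
apply: eps1; first split=> [|f g f0 g0|h f f0|h f f0].
- exact: mcoeff0.
- by rewrite /eps mcoeffD -/eps f0 g0 addr0.
- by rewrite epsM f0 mulr0.
- by rewrite epsM f0 mul0r.
move=> g [u [s [us ->]]]; case/lastP: s us => // s v _.
by rewrite /lncomm -cats1 foldl_cat /= epsB !epsM mulrC subrr.
Qed.

HB.instance Definition _ := GRing.PzSemiRing_isNonZero.Build
  (relfree K n p.+1) relfree_oner_neq0.
HB.instance Definition _ := GRing.Lmodule_isLalgebra.Build K
  (relfree K n p.+1) (@quot_scaleAl _ _ _ (relfree_ideal_is_ideal K n p.+1)).
HB.instance Definition _ := GRing.Lalgebra_isAlgebra.Build K
  (relfree K n p.+1) (@quot_scaleAr _ _ _ (relfree_ideal_is_ideal K n p.+1)).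

End RelativelyFreeAlgebra.

(* Main.v *)
Require Import Defs.
From HB Require Import structures.
From mathcomp Require Import all_boot all_order all_algebra.
From mathcomp Require Import monalg.

Set Implicit Arguments.
Unset Strict Implicit.
Unset Printing Implicit Defensive.

Import GRing.Theory.

Local Open Scope ring_scope.

(** Every polynomial can be written as a combination of products w x^a, with
    x^a an ordered monomial in the variables and w a product of left-normed
    commutators of variables (pbw_total).  Substituting x_i + 1 for x_i fixes
    the commutators and lowers the degree of x^a, so the coefficients w of an
    identity are again identities (Tideal_top_coef, Tideal_elimination).
    Substituting 0 for variables then splits a combination of commutator
    products according to the set of variables that occur
    (proper_identity_split).  Two cases remain.
    If at most n variables occur, the combination can be evaluated at
    generators of F_n(N_3), and being an identity it lies in I_4.  If more than
    n >= 4 variables occur, every product has degree greater than n, and then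
    it is in I_4 unless all its factors are of length 2, in which case it has
    at least k = floor(n/2) + 1 factors and is a consequence of the product of
    k commutators (comm_mon_long).

    Conversely, the product of k commutators vanishes on F_n(N_3).  From
    [x1, x2, x3, x4] = 0 one derives [a, b, c][d, e] = 0 (brk3_brk2) and
    ([a, d][b, c] + [a, c][b, d])[e, f] = 0 (brk_swap).  Hence a product of at
    least three commutators is an alternating function of all its entries and
    behaves as a derivation in each of them, so that it vanishes as soon as it
    has more than n entries (brk_prod_rank); here 2k > n.  The bound k >= 3,
    that is n >= 4, is what makes the alternation available.

    Both parities of n give the same k, since n.+2./2 and n.+1./2 respectively
    equal n./2.+1. *)

(** * Commutator identities in Lie nilpotent rings of class 3 *)

(** Stated on rings that may be trivial, because the quotient of the free
    algebra by an arbitrary T-ideal may be; locked, so that rewriting with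
    the derivation rules does not see the difference inside a commutator. *)
Definition brk (R : pzRingType) (a b : R) : R := locked (a * b - b * a).

Local Notation "{[ a , b ]}" := (brk a b) (at level 0).
Local Notation "{[ a , b , c ]}" := (brk (brk a b) c) (at level 0).

Section BracketCalculus.
Context (R : pzRingType).
Implicit Types a b c d e f z : R.

Lemma brkE a b : {[a, b]} = a * b - b * a.
Proof. by rewrite /brk -lock. Qed.

Lemma brkC a b : {[a, b]} = - {[b, a]}.
Proof. by rewrite !brkE opprB. Qed.

Lemma brkxx a : {[a, a]} = 0.
Proof. by rewrite brkE subrr. Qed.

Lemma brk0l a : {[0, a]} = 0.
Proof. by rewrite !brkE mulr0 mul0r subrr. Qed.

Lemma brkDl a b c : {[a + b, c]} = {[a, c]} + {[b, c]}.
Proof. by rewrite !brkE mulrDl mulrDr opprD addrACA. Qed.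

Lemma brkNl a b : {[- a, b]} = - {[a, b]}.
Proof. by rewrite !brkE mulNr mulrN opprD. Qed.

Lemma brkMl a b c : {[a * b, c]} = a * {[b, c]} + {[a, c]} * b.
Proof. by rewrite !brkE mulrBr mulrBl !mulrA subrKA. Qed.

Lemma brkMr a b c : {[a, b * c]} = b * {[a, c]} + {[a, b]} * c.
Proof. by rewrite !brkE mulrBr mulrBl !mulrA [RHS]addrC subrKA. Qed.

Lemma brk_leibniz a b c : {[a, b, c]} = {[a, c, b]} + {[a, {[b, c]}]}.
Proof.
rewrite {1}[{[a, b]}]brkE brkDl brkNl !brkMl opprD [X in _ + X]addrC.
by rewrite addrACA addrC -!brkE.
Qed.

Lemma brk_jacobi a b c : {[a, b, c]} + {[b, c, a]} + {[c, a, b]} = 0.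
Proof.
rewrite brk_leibniz [{[a, {[b, c]}]}]brkC [{[c, a]}]brkC brkNl.
by rewrite addrNK subrr.
Qed.

Lemma mulr_swap a b c : a * b * c = a * c * b - a * {[c, b]}.
Proof. by rewrite brkE mulrBr !mulrA opprB addrC subrK. Qed.

End BracketCalculus.

Definition entries (T : Type) (s : seq (T * T)) : seq T :=
  flatten [seq [:: p.1; p.2] | p <- s].

Lemma size_entries (T : Type) (s : seq (T * T)) :
  size (entries s) = (size s).*2.
Proof. by elim: s => //= p s ->. Qed.

Section LieNilpotentClass3.
Context (R : pzRingType).
Implicit Types a b c d e f z : R.
Hypothesis nil3 : forall a b c d, {[{[a, b, c]}, d]} = 0.

Lemma brk3_central a b c z : z * {[a, b, c]} = {[a, b, c]} * z.
Proof. by apply/esym/subr0_eq; rewrite -brkE nil3. Qed.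

Lemma brk_brkC a b c d : {[a, b]} * {[c, d]} = {[c, d]} * {[a, b]}.
Proof.
apply/subr0_eq; rewrite -brkE; have := brk_leibniz {[a, b]} c d.
by rewrite !nil3 add0r => /esym.
Qed.

Hypothesis tors3 : forall a, a *+ 3 = 0 -> a = 0.

(** Expanding [a, b, cd, e] = 0 and [ab, c, d, e] = 0 shows that
    [a, b, c][d, e] changes sign under transpositions that generate the whole
    symmetric group of its entries.  For an alternating function the three
    terms of the Jacobi identity coincide, whence 3 [a, b, c][d, e] = 0. *)
Lemma brk3_brk2 a b c d e : {[a, b, c]} * {[d, e]} = 0.
Proof.
pose t a b c d e := {[a, b, c]} * {[d, e]}.
have swap12 u v w x y : t v u w x y = - t u v w x y.
  by rewrite /t [{[v, u]}]brkC brkNl mulNr.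
have swap45 u v w x y : t u v w y x = - t u v w x y.
  by rewrite /t [{[y, x]}]brkC mulrN.
have swap34 u v w x y : t u v x w y = - t u v w x y.
  apply/eqP; rewrite -addr_eq0 -[t _ _ x _ _]brk3_central; apply/eqP.
  (* The expansion of [u, v, wx, y] = 0. *)
  have := nil3 u v (w * x) y; rewrite brkMr brkDl !brkMl !nil3.
  by rewrite mulr0 mul0r add0r addr0.
have swap35 u v w x y : t u v y x w = - t u v w x y.
  by rewrite swap34 swap45 swap34 opprK.
have swap14 u v w x y : t x v w u y = - t u v w x y.
  (* The expansion of [ux, y, v, w] = 0; four of its six terms cancel. *)
  have := nil3 (u * x) y v w; rewrite !(brkMl, brkDl) !nil3 mulr0 mul0r.
  rewrite add0r addr0 ![_ * {[_, _, _]}]brk3_central -!/(t _ _ _ _ _).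
  rewrite [t x y w u v]swap35 [t u y w x v]swap35.
  by rewrite addNKr addrNK addrC => /eqP; rewrite addr_eq0 => /eqP.
have cycle123 u v w x y : t v w u x y = t u v w x y.
  rewrite swap12 -[t u v w x y]opprK; congr (- _).
  by rewrite [t w v u x y]swap14 [t x v u w y]swap34 [t x v w u y]swap14 !opprK.
have := congr1 ( *%R^~ {[d, e]}) (brk_jacobi a b c).
rewrite /= !mulrDl mul0r -!/(t _ _ _ _ _) [t c a b d e]cycle123.
rewrite [t b c a d e]cycle123 => t3.
by apply: tors3; rewrite mulrSr mulr2n.
Qed.

Hypothesis tors2 : forall a, a *+ 2 = 0 -> a = 0.

(** This is [ab, c, d][e, f] = 0 after expansion. *)
Lemma brk_swap a b c d e f :
  ({[a, d]} * {[b, c]} + {[a, c]} * {[b, d]}) * {[e, f]} = 0.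
Proof.
have := brk3_brk2 (a * b) c d e f; rewrite !(brkMl, brkDl) !mulrDl.
rewrite -[_ * b]brk3_central -[a * _ * _]mulrA -[b * _ * _]mulrA !brk3_brk2.
by rewrite !mulr0 add0r addr0.
Qed.

Lemma brk_common a b c e f : {[a, c]} * {[b, c]} * {[e, f]} = 0.
Proof. by apply: tors2; rewrite mulr2n -mulrDl brk_swap. Qed.

Definition brk_prod (s : seq (R * R)) : R := \prod_(p <- s) {[p.1, p.2]}.

Lemma brk_prodC s t : brk_prod s * brk_prod t = brk_prod t * brk_prod s.
Proof.
apply: commr_prod => p _; apply/esym/commr_prod => q _.
exact: brk_brkC.
Qed.

Lemma brk_prod_cons p s : brk_prod (p :: s) = {[p.1, p.2]} * brk_prod s.
Proof. exact: big_cons. Qed.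

Lemma brk_prod_cat s t : brk_prod (s ++ t) = brk_prod s * brk_prod t.
Proof. exact: big_cat. Qed.

Lemma brk_prod_move p s t : brk_prod (s ++ p :: t) = brk_prod (p :: s ++ t).
Proof.
rewrite brk_prod_cat !brk_prod_cons brk_prod_cat !mulrA; congr (_ * _).
by have := brk_prodC s [:: p]; rewrite /brk_prod !big_seq1.
Qed.

Lemma brk3_brk_prod a b c s : s != [::] -> {[a, b, c]} * brk_prod s = 0.
Proof.
by case: s => // p s _; rewrite brk_prod_cons mulrA brk3_brk2 mul0r.
Qed.

(** The factor that shares an entry with the first one is moved next to it;
    a third factor then allows brk_common to be applied.  The second sequence
    collects the factors already known to be disjoint from the others, which
    keeps the number of factors at least 3 during the induction. *)
Lemma brk_prod_repeat (T : eqType) (x : T -> R) (s t : seq (T * T)) :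
  (3 <= size s + size t)%N -> ~~ uniq (entries s) ->
  brk_prod [seq (x p.1, x p.2) | p <- s ++ t] = 0.
Proof.
have common p q u : u != [::] ->
    (p.1 \in [:: q.1; q.2]) || (p.2 \in [:: q.1; q.2]) ->
    {[x p.1, x p.2]} * {[x q.1, x q.2]} * brk_prod u = 0.
  case: u => // r u _; rewrite brk_prod_cons mulrA.
  have com (a b c : T) : {[x a, x c]} * {[x b, x c]} * {[r.1, r.2]} = 0.
    exact: brk_common.
  have com' (a b c : T) : {[x c, x a]} * {[x b, x c]} * {[r.1, r.2]} = 0.
    by rewrite brkC !mulNr com oppr0.
  rewrite !inE -orbA => /or4P[] /eqP->; rewrite ?com' ?com ?mul0r //;
    by rewrite [{[x q.1, x q.2]}]brkC mulrN mulNr ?com ?com' oppr0 mul0r.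
elim: s t => [|[i j] s IHs] t //= size_st.
rewrite !inE !negb_and !negbK -/(entries s) -orbA.
have common_entry k : k \in entries s -> k \in [:: i; j] ->
    brk_prod ((x i, x j) :: [seq (x p.1, x p.2) | p <- s ++ t]) = 0.
  case/flatten_mapP=> q q_s kq k_ij; case/splitPr: q_s size_st => s1 s2 size_st.
  rewrite -catA /= map_cat brk_prod_cons /= brk_prod_move brk_prod_cons mulrA.
  apply: (common (i, j) q).
    rewrite -map_cat -size_eq0 size_map !size_cat.
    by move: size_st; rewrite size_cat /= addnS !addSn addnA; case: (_ + _)%N.
  by move: k_ij kq; rewrite !inE => /orP[] /eqP <- ->; rewrite ?orbT.
case/or4P=> [/eqP->|i_s|j_s|repeat_s].
- by rewrite brk_prod_cons brkxx mul0r.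
- exact: (common_entry i i_s (mem_head _ _)).
- by apply: (common_entry j j_s); rewrite !inE eqxx orbT.
rewrite map_cat -brk_prod_move -[_ :: _]/(map _ ((i, j) :: t)) -map_cat.
by apply: IHs; rewrite // addnS.
Qed.

End LieNilpotentClass3.

Section FinitelyGenerated.
Context (K : nzRingType) (A : algType K) (n : nat) (x : 'I_n -> A).
(* The x i generate A, as an induction principle on left-normed words. *)
Hypothesis gen_x : forall Q : A -> Prop,
  (forall k : K, Q k%:A) -> (forall a b, Q a -> Q b -> Q (a + b)) ->
  (forall a i, Q a -> Q (a * x i)) -> forall a, Q a.
Hypothesis nil3 : forall a b c d : A, {[{[a, b, c]}, d]} = 0.
Hypothesis tors3 : forall a : A, a *+ 3 = 0 -> a = 0.
Hypothesis tors2 : forall a : A, a *+ 2 = 0 -> a = 0.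

Lemma brk_scalar (k : K) (a : A) : {[k%:A, a]} = 0.
Proof. by rewrite brkE mulr_algl mulr_algr subrr. Qed.

(** Next to another commutator, [_, b] is a derivation whose values commute
    with A: the error term [a, b, x i] is killed by brk3_brk2.  So vanishing
    has to be checked on generators only. *)
Lemma brk_prod_gen (b : A) s : s != [::] ->
  (forall i, {[x i, b]} * brk_prod s = 0) ->
  forall a, {[a, b]} * brk_prod s = 0.
Proof.
move=> s_neq0 x0; apply: gen_x => [k|a c a0 c0|a i a0].
- by rewrite brk_scalar mul0r.
- by rewrite brkDl mulrDl a0 c0 addr0.
rewrite brkMl mulrDl -mulrA x0 mulr0 add0r.
rewrite -[_ * x i](subrK (x i * {[a, b]})) -brkE mulrDl -mulrA a0 mulr0 addr0.
exact: brk3_brk_prod.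
Qed.

(** By brk_prod_gen all entries can be taken among the n generators, and then
    one of them is repeated. *)
Lemma brk_prod_rank (s : seq (A * A)) :
  (3 <= size s)%N -> (n < (size s).*2)%N -> brk_prod s = 0.
Proof.
suff gen_vanish (t : seq ('I_n * 'I_n)) :
    (3 <= size s + size t)%N -> (n < (size s + size t).*2)%N ->
    brk_prod (s ++ [seq (x p.1, x p.2) | p <- t]) = 0.
  by move=> s3 sn; rewrite -(gen_vanish [::]) ?cats0 ?addn0.
elim: s t => [|[a b] s IHs] t st3 stn.
  have := brk_prod_repeat nil3 tors3 tors2 x (s := t) (t := [::]).
  rewrite cats0 addn0; apply=> //; apply/negP => /card_uniqP card_t.
  have := max_card (mem (entries t)).
  by rewrite card_t card_ord size_entries leqNgt stn.
rewrite cat_cons brk_prod_cons /=.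
have st_neq0 : s ++ [seq (x p.1, x p.2) | p <- t] != [::].
  rewrite -size_eq0 size_cat size_map; move: st3 => /=.
  by rewrite addSn; case: (_ + _)%N.
apply: brk_prod_gen => // i; rewrite brkC mulNr.
rewrite brk_prod_gen ?oppr0 // => j.
rewrite -[_ * _]/({[(x j, x i).1, (x j, x i).2]} * _) -brk_prod_cons.
rewrite -brk_prod_move //.
by apply: (IHs ((j, i) :: t)); rewrite /= addnS -addSn.
Qed.

End FinitelyGenerated.

(** * Free and relatively free algebras *)

Section FreeAlgebraTheory.
Context (K : comNzRingType) (I : choiceType).

Lemma freealg_ind (Q : freealg K I -> Prop) :
  (forall k : K, Q k%:A) -> (forall f g, Q f -> Q g -> Q (f + g)) ->
  (forall f i, Q f -> Q (f * fvar K i)) -> forall f, Q f.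
Proof.
move=> QC QD QX f; rewrite [f]monalgE.
have Q0 : Q 0 by rewrite -(scale0r 1).
elim/big_ind: _ => // m _; move: (f@_m) => c; rewrite -[m]fmK.
elim/last_ind: (m : seq I) => [|s i IHs].
  suff -> : << c *g FMonom [::] >> = c%:A :> freealg K I by [].
  by rewrite -[c%:A]mul_malgC mulr1 /mone /= fmoneE.
suff -> : << c *g FMonom (rcons s i) >>
    = (<< c *g FMonom s >> : freealg K I) * fvar K i.
  exact: QX.
rewrite /fvar malgM_def fgmulUU mulr1; congr << c *g _ >>.
by apply/eqP; rewrite fmP fmM fmU cats1.
Qed.

Lemma feval_fvar (A : algType K) (a : I -> A) i : feval a (fvar K i) = a i.
Proof.
rewrite /feval /fvar mmapU /word_eval fmU big_seq1.
by rewrite -[RHS]mul1r; congr (_ * _); rewrite /= scale1r.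
Qed.

End FreeAlgebraTheory.

(** A homomorphism out of the free algebra is determined by the images of the
    variables; this is the form in which compositions of substitutions are
    computed. *)
Lemma feval_comp (K : comNzRingType) (I : choiceType) (A B : algType K)
    (phi : {lrmorphism A -> B}) (a : I -> A) f :
  phi (feval a f) = feval (fun i => phi (a i)) f.
Proof.
elim/freealg_ind: f => [k|f g IHf IHg|f i IHf].
- by rewrite !linearZ /= !rmorph1.
- by rewrite !raddfD /= IHf IHg.
- by rewrite !rmorphM /= IHf !feval_fvar.
Qed.

Lemma feval_id (K : comNzRingType) (I : choiceType) (f : freealg K I) :
  feval (@fvar K I) f = f.
Proof.
elim/freealg_ind: f => [k|f g IHf IHg|f i IHf].
- by rewrite linearZ /= rmorph1.
- by rewrite raddfD /= IHf IHg.
- by rewrite rmorphM /= IHf feval_fvar.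
Qed.

Lemma commE (R : nzRingType) (a b : R) : comm a b = {[a, b]}.
Proof. by rewrite brkE. Qed.

Lemma rmorph_commutator (R S : nzRingType) (phi : {rmorphism R -> S}) a b :
  phi (comm a b) = comm (phi a) (phi b).
Proof. by rewrite /comm rmorphB !rmorphM. Qed.

Lemma rmorph_lncomm (R S : nzRingType) (phi : {rmorphism R -> S}) (a : R) s :
  phi (lncomm a s) = lncomm (phi a) (map phi s).
Proof.
by rewrite /lncomm; elim: s a => //= b s IHs a; rewrite IHs rmorph_commutator.
Qed.

Lemma Id_Tideal (K : comNzRingType) (A : algType K) : is_Tideal (@Id K A).
Proof.
split=> [|phi f Idf a].
  split=> [a|f g f0 g0 a|h f f0 a|h f f0 a];
    rewrite ?raddf0 ?raddfD ?rmorphM //=.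
  - by rewrite f0 g0 addr0.
  - by rewrite f0 mulr0.
  - by rewrite f0 mul0r.
by rewrite -[f]feval_id !feval_comp Idf.
Qed.

Section RelativelyFreeTheory.
Context (K : comNzRingType) (n p : nat).
Local Notation A := (relfree K n p.+1).

(** The quotient map, given as a function so that it can carry the structure
    of an algebra morphism. *)
Definition relfree_proj (f : freealg K 'I_n) : A := (\pi_A f)%qT.

Fact relfree_proj_zmod_morphism : zmod_morphism relfree_proj.
Proof.
move=> f g; rewrite /relfree_proj.
by rewrite -[RHS]/(quot_add _ (quot_opp _)) quot_oppE quot_addE.
Qed.
HB.instance Definition _ := GRing.isZmodMorphism.Build (freealg K 'I_n) A
  relfree_proj relfree_proj_zmod_morphism.

Fact relfree_proj_monoid_morphism : monoid_morphism relfree_proj.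
Proof. by split=> // f g; rewrite -[RHS]/(quot_mul _ _) quot_mulE. Qed.
HB.instance Definition _ := GRing.isMonoidMorphism.Build (freealg K 'I_n) A
  relfree_proj relfree_proj_monoid_morphism.

Fact relfree_proj_scalable : scalable relfree_proj.
Proof. by move=> k f; rewrite -[RHS]/(quot_scale _ _) quot_scaleE. Qed.
HB.instance Definition _ := GRing.isScalable.Build K (freealg K 'I_n) A *:%R
  relfree_proj relfree_proj_scalable.

Lemma relfree_proj_eq0 f : relfree_proj f = 0 <-> comm_ideal p.+2 (free_incl f).
Proof.
rewrite -[0]/(relfree_proj 0) /relfree_proj ideal_quot_eqP subr0.
by [].
Qed.

Lemma relfree_proj_surj (a : A) : exists f, a = relfree_proj f.
Proof. by exists (repr a); rewrite /relfree_proj reprK. Qed.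

Lemma relfree_ind (Q : A -> Prop) :
  (forall k : K, Q k%:A) -> (forall a b, Q a -> Q b -> Q (a + b)) ->
  (forall a i, Q a -> Q (a * relfree_proj (fvar K i))) -> forall a, Q a.
Proof.
move=> QC QD QX a; have [f ->] := relfree_proj_surj a.
elim/freealg_ind: f => [k|f g Qf Qg|f i Qf].
- by rewrite linearZ /= rmorph1.
- by rewrite raddfD; apply: QD.
- by rewrite rmorphM; apply: QX.
Qed.

Lemma relfree_lncomm (a : A) s : size s = p.+1 -> lncomm a s = 0.
Proof.
have [f ->] := relfree_proj_surj a => size_s.
have ->: s = map relfree_proj (map repr s).
  by rewrite -map_comp map_id_in // => b _; rewrite /= /relfree_proj reprK.
rewrite -rmorph_lncomm; apply/relfree_proj_eq0 => J JI; apply.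
exists (free_incl f), (map (@free_incl K n) (map repr s)).
by rewrite /= !size_map size_s rmorph_lncomm.
Qed.

End RelativelyFreeTheory.

Lemma idealZ (K : nzRingType) (A : algType K) (V : A -> Prop) (c : K) f :
  is_ideal V -> V f -> V (c *: f).
Proof. by move=> VI Vf; rewrite -mulr_algl; apply: (idealMl VI). Qed.

Lemma ideal_mul_inner (R : nzRingType) (V : R -> Prop) (a b c d : R) :
  is_ideal V -> V (b * c) -> V ((a * b) * (c * d)).
Proof.
move=> VI Vbc; rewrite -mulrA [b * _]mulrA.
by apply: (idealMl VI); apply: (Defs.idealMr VI).
Qed.

Lemma torsion_free (K : fieldType) (V : lmodType K) (m : nat) (v : V) :
  [pchar K] =i pred0 -> v *+ m.+1 = 0 -> v = 0.
Proof.
move=> /pcharf0P charK0; rewrite -scaler_nat => /eqP.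
by rewrite scaler_eq0 charK0 => /eqP.
Qed.

Lemma feval_comm_prod (K : comNzRingType) (A : algType K) (a : nat -> A) k :
  feval a (comm_prod K k)
  = brk_prod [seq (a i.*2, a i.*2.+1) | i <- iota 0 k].
Proof.
rewrite /comm_prod /brk_prod big_map rmorph_prod.
rewrite -[X in iota _ X]subn0 big_mkord; apply: eq_bigr => i _.
by rewrite rmorph_commutator /= !feval_fvar commE.
Qed.

Lemma Tideal_gen_Tideal (K : comNzRingType) S : is_Tideal (@Tideal_gen K S).
Proof.
split; last by move=> phi f Sf J JT SJ; apply: JT.2; apply: Sf.
split=> [J|f g Sf Sg J|h f Sf J|h f Sf J] JT SJ; have JI := JT.1.
- exact: ideal0 JI.
- by apply: (idealD JI); [apply: Sf | apply: Sg].
- by apply: (idealMl JI); apply: Sf.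
- by apply: (Defs.idealMr JI); apply: Sf.
Qed.

Definition N3_gens (K : comNzRingType) (k : nat) (g : freealg K nat) : Prop :=
  g = lncomm (fvar K 0%N) [:: fvar K 1%N; fvar K 2%N; fvar K 3%N]
  \/ g = comm_prod K k.

(** * The generators are identities *)

Section Generators.
Context (K : fieldType) (n k : nat).
Hypothesis charK0 : [pchar K] =i pred0.
Hypothesis k3 : (3 <= k)%N.
Hypothesis nk : (n < k.*2)%N.

Lemma relfree_nil3 (a b c d : relfree K n 3) : {[{[a, b, c]}, d]} = 0.
Proof.
by have := relfree_lncomm a (s := [:: b; c; d]) erefl; rewrite /= !commE.
Qed.

Lemma N3_gens_Id f : N3_gens k f -> Id (relfree K n 3) f.
Proof.
case=> -> a; first by rewrite rmorph_lncomm relfree_lncomm.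
have tors m (b : relfree K n 3) : b *+ m.+1 = 0 -> b = 0.
  exact: torsion_free.
rewrite feval_comm_prod.
apply: (brk_prod_rank (@relfree_ind K n 2) relfree_nil3 (tors 2%N) (tors 1%N)).
- by rewrite size_map size_iota.
- by rewrite size_map size_iota.
Qed.

Lemma Tideal_gen_Id f : Tideal_gen (@N3_gens K k) f -> Id (relfree K n 3) f.
Proof. by apply; [apply: Id_Tideal | apply: N3_gens_Id]. Qed.

End Generators.

(** * Consequences of the generators *)

Section IdealBrackets.
Context (K : fieldType).
Local Notation KX := (freealg K nat).
Context (J : KX -> Prop) (JT : is_Tideal J).
Hypothesis charK0 : [pchar K] =i pred0.
Let JI : is_ideal J := JT.1.

Lemma Tideal_feval a f : J f -> J (feval a f).
Proof. exact: (JT.2 (feval a)). Qed.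

Lemma Tideal_lncomm f s : J f -> J (lncomm f s).
Proof.
rewrite /lncomm; elim: s f => //= g s IHs f Jf; apply: IHs.
apply: (idealD JI); first exact: (Defs.idealMr JI).
by apply: (idealN JI); apply: (idealMl JI).
Qed.

Lemma Tideal_prod k (s : seq (KX * KX)) :
  J (comm_prod K k) -> (k <= size s)%N -> J (brk_prod s).
Proof.
move=> Jk ks; rewrite -(cat_take_drop k s) brk_prod_cat.
apply: (Defs.idealMr JI).
have size_tk : size (take k s) = k by rewrite size_takel.
pose a m := let p := nth (0, 0) (take k s) m./2 in if odd m then p.2 else p.1.
suff -> : brk_prod (take k s) = feval a (comm_prod K k) by apply: Tideal_feval.
rewrite feval_comm_prod; congr brk_prod.
rewrite -[LHS](mkseq_nth (0, 0)) size_tk.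
apply: eq_map => i; rewrite /a /= odd_double uphalf_double doubleK.
by case: (nth _ _ _).
Qed.

Hypothesis J4 : J (lncomm (fvar K 0%N) [:: fvar K 1%N; fvar K 2%N; fvar K 3%N]).

Lemma Tideal_lncomm4 f g h l : J (lncomm f [:: g; h; l]).
Proof.
have := Tideal_feval (nth 0 [:: f; g; h; l]) J4.
by rewrite rmorph_lncomm /= !feval_fvar.
Qed.

Lemma comm_ideal_sub f : comm_ideal 4 f -> J f.
Proof.
apply=> // g [u [[|v [|w [|y [|? ?]]]] [//] _ ->]].
exact: Tideal_lncomm4.
Qed.

Local Notation Q := (ideal_quot JI).
Local Notation pi := (\pi_(ideal_quot JI))%qT.

Lemma pi_brk f g : {[pi f, pi g]} = pi {[f, g]}.
Proof.
rewrite !brkE.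
rewrite -[LHS]/(quot_add (quot_mul _ _) (quot_opp (quot_mul _ _))).
by rewrite !quot_mulE quot_oppE quot_addE.
Qed.

(** The identity brk3_brk2, applied in the quotient by the ideal. *)
Lemma Tideal_brk3_brk2 f g h u v : J ({[f, g, h]} * {[u, v]}).
Proof.
have nil3 (a b c d : Q) : {[{[a, b, c]}, d]} = 0.
  rewrite -[a]reprK -[b]reprK -[c]reprK -[d]reprK !pi_brk.
  by apply/ideal_quot_eqP; rewrite subr0 -!commE; apply: Tideal_lncomm4.
have tors3 (a : Q) : a *+ 3 = 0 -> a = 0 by apply: torsion_free.
have := brk3_brk2 nil3 tors3 (pi f) (pi g) (pi h) (pi u) (pi v).
rewrite !pi_brk -[LHS]/(quot_mul _ _) quot_mulE => /ideal_quot_eqP.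
by rewrite subr0.
Qed.

Lemma Tideal_brk2_brk3 f g h u v : J ({[u, v]} * {[f, g, h]}).
Proof.
have -> : {[u, v]} * {[f, g, h]}
    = {[f, g, h]} * {[u, v]} - {[{[f, g, h]}, {[u, v]}]}.
  by rewrite [X in _ - X]brkE opprB addrC subrK.
apply: (idealD JI); first exact: Tideal_brk3_brk2.
by apply: (idealN JI); rewrite -!commE; apply: Tideal_lncomm4.
Qed.

End IdealBrackets.

(** * Products of commutators of variables *)

Section ProperPolynomials.
Context (K : fieldType).
Local Notation KX := (freealg K nat).
Local Notation "''x_' i" := (fvar K i%N : KX)
  (at level 8, i at level 2, format "''x_' i").

(** Words of length 1 give variables, so that a commutator can be built letter
    by letter; the value at the empty word is a dummy. *)
Definition lcomm (w : seq nat) : KX :=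
  if w is i :: s then lncomm 'x_i [seq 'x_j | j <- s] else 0.

Definition comm_mon (L : seq (seq nat)) : KX := \prod_(w <- L) lcomm w.

Definition is_comm_mon (L : seq (seq nat)) : bool :=
  all (fun w => 1 < size w)%N L.

Definition lin_comb (s : seq (K * seq (seq nat))) : KX :=
  \sum_(t <- s) t.1 *: comm_mon t.2.

(** These are the proper polynomials.  The terms are kept as lists, with their
    degrees and variables readable from the indices, because they are later
    sorted by the variables that occur in them. *)
Definition is_proper (f : KX) : Prop :=
  exists2 s, all (fun t => is_comm_mon t.2) s & f = lin_comb s.

Lemma comm_mon_cons w L : comm_mon (w :: L) = lcomm w * comm_mon L.
Proof. exact: big_cons. Qed.

Lemma comm_mon_cat L1 L2 : comm_mon (L1 ++ L2) = comm_mon L1 * comm_mon L2.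
Proof. exact: big_cat. Qed.

Lemma comm_mon_rcons L w : comm_mon (rcons L w) = comm_mon L * lcomm w.
Proof. exact: big_rcons. Qed.

Lemma lcomm_rcons w j : w != [::] -> lcomm (rcons w j) = {[lcomm w, 'x_j]}.
Proof.
by case: w => //= i s _; rewrite map_rcons /lncomm foldl_rcons commE.
Qed.

Lemma feval_lcomm (A : algType K) (a : nat -> A) i s :
  feval a (lcomm (i :: s)) = lncomm (a i) (map a s).
Proof.
rewrite /= rmorph_lncomm /= feval_fvar -map_comp; congr lncomm.
by apply: eq_map => j /=; rewrite feval_fvar.
Qed.

Lemma feval_comm_mon (a : nat -> KX) L :
  {in flatten L, forall i, a i = 'x_i} -> feval a (comm_mon L) = comm_mon L.
Proof.
move=> aE; rewrite /comm_mon rmorph_prod; apply: eq_big_seq => -[|i s] wL.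
  by rewrite /= raddf0.
rewrite /= -/(lcomm (i :: s)) feval_lcomm aE.
  congr lncomm; apply/eq_in_map => j js; apply: aE; apply/flattenP.
  by exists (i :: s); rewrite // inE js orbT.
by apply/flattenP; exists (i :: s); rewrite // mem_head.
Qed.

Lemma feval_lin_comb (a : nat -> KX) s :
  (forall t, t \in s -> {in flatten t.2, forall i, a i = 'x_i}) ->
  feval a (lin_comb s) = lin_comb s.
Proof.
move=> aE; rewrite /lin_comb linear_sum; apply: eq_big_seq => t ts.
by rewrite linearZ /= feval_comm_mon //; apply: aE.
Qed.

Lemma lncomm0 (R : nzRingType) (a : R) s : 0 \in a :: s -> lncomm a s = 0.
Proof.
rewrite inE => /orP[/eqP <-|].
  by elim: s => //= b s IHs; rewrite commE brk0l.
elim: s a => //= b s IHs a; rewrite inE => /orP[/eqP <-|/IHs //].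
rewrite /comm mulr0 mul0r subrr.
by elim: s {IHs} => //= c s IHs; rewrite commE brk0l.
Qed.

Definition kill (i : nat) : KX -> KX :=
  feval (fun j => if j == i then 0 else 'x_j).
HB.instance Definition _ i := GRing.LRMorphism.on (kill i).

Lemma kill_comm_mon i L :
  kill i (comm_mon L) = if i \in flatten L then 0 else comm_mon L.
Proof.
case: ifPn => [/flattenP[w wL iw]|iL]; last first.
  by apply: feval_comm_mon => j jL; case: eqP => // ji; rewrite -ji jL in iL.
have kill_w : kill i (lcomm w) = 0.
  case: w iw {wL} => // j s ijs; rewrite /kill feval_lcomm; apply: lncomm0.
  apply/(@mapP _ _ (fun j => if j == i then 0 else 'x_j) (j :: s)).
  by exists i; rewrite ?eqxx.
case/splitPr: wL => L1 L2; rewrite /comm_mon big_cat big_cons !rmorphM /=.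
by rewrite kill_w mul0r mulr0.
Qed.

Definition shift (i : nat) : KX -> KX := feval (fun j => 'x_j + (j == i)%:R).
HB.instance Definition _ i := GRing.LRMorphism.on (shift i).

Lemma shift_fvar i j : shift i 'x_j = 'x_j + (j == i)%:R.
Proof. exact: feval_fvar. Qed.

Lemma shift_lcomm i w : (1 < size w)%N -> shift i (lcomm w) = lcomm w.
Proof.
have brkDn (R : nzRingType) (a b : R) m : {[a, b + m%:R]} = {[a, b]}.
  by rewrite !brkE mulrDr mulrDl mulr_natr mulr_natl opprD addrACA subrr addr0.
have shift_brk a b : shift i {[a, b]} = {[shift i a, shift i b]}.
  by rewrite -!commE; apply: (rmorph_commutator (shift i)).
elim/last_ind: w => // -[|j [|l w]] k IHw // _.
  rewrite (@lcomm_rcons [:: j] k isT) shift_brk !(shift_fvar i _) brkDn.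
  by rewrite brkC brkDn -brkC.
rewrite (@lcomm_rcons [:: j, l & w] k isT) shift_brk (IHw isT).
by rewrite shift_fvar brkDn.
Qed.

Lemma shift_proper i f : is_proper f -> shift i f = f.
Proof.
case=> s s_comm ->; rewrite /lin_comb linear_sum; apply: eq_big_seq => t ts.
rewrite linearZ /= /comm_mon rmorph_prod; congr (_ *: _).
apply: eq_big_seq => w wt; apply: shift_lcomm.
exact: (allP (allP s_comm _ ts)).
Qed.

End ProperPolynomials.

(** * Ordered form of polynomials *)

Section OrderedMonomials.
Context (K : fieldType).
Local Notation KX := (freealg K nat).
Local Notation "''x_' i" := (fvar K i%N : KX)
  (at level 8, i at level 2, format "''x_' i").

(** The span of the products w x_0^a_0 ... x_(m-1)^a_(m-1) with w proper,
    as in the Poincare-Birkhoff-Witt theorem.  It is built one variable at a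
    time, as values at x_m of polynomials with coefficients on the left, so
    that variables can be eliminated one at a time as well. *)
Fixpoint pbw (m : nat) (f : KX) : Prop :=
  if m is m'.+1 then
    exists2 p : {poly KX}, (forall k, pbw m' p`_k) & f = p.['x_m']
  else is_proper f.

Lemma pbw0 m : pbw m 0.
Proof.
elim: m => [|m IHm] /=; first by exists [::]; rewrite ?/lin_comb ?big_nil.
by exists 0; rewrite ?horner0 // => k; rewrite coef0.
Qed.

Lemma pbwD m f g : pbw m f -> pbw m g -> pbw m (f + g).
Proof.
elim: m f g => [|m IHm] f g /=.
  case=> s s_comm -> [t t_comm ->]; exists (s ++ t).
    by rewrite all_cat s_comm.
  by rewrite /lin_comb big_cat.
case=> p pP -> [q qP ->]; exists (p + q); last by rewrite hornerD.
by move=> k; rewrite coefD; apply: IHm.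
Qed.

Lemma pbwN m f : pbw m f -> pbw m (- f).
Proof.
elim: m f => [|m IHm] f /=.
  case=> s s_comm ->; exists [seq (- t.1, t.2) | t <- s].
    by rewrite all_map.
  by rewrite /lin_comb big_map -sumrN; apply: eq_bigr => t _; rewrite scaleNr.
case=> p pP ->; exists (- p); last by rewrite hornerN.
by move=> k; rewrite coefN; apply: IHm.
Qed.

Lemma pbw_const m c : pbw m c%:A.
Proof.
elim: m => [|m IHm] /=.
  by exists [:: (c, [::])]; rewrite // /lin_comb big_seq1 /comm_mon big_nil.
exists c%:A%:P; last by rewrite hornerC.
by move=> k; rewrite coefC; case: ifP => _ //; apply: pbw0.
Qed.

Lemma pbwS m f : pbw m f -> pbw m.+1 f.
Proof.
move=> mf; exists f%:P; last by rewrite hornerC.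
by move=> k; rewrite coefC; case: ifP => _ //; apply: pbw0.
Qed.

Lemma pbw_mono m1 m2 f : (m1 <= m2)%N -> pbw m1 f -> pbw m2 f.
Proof.
by move=> le_m mf; rewrite -(subnK le_m); elim: (_ - _)%N => //= k; apply: pbwS.
Qed.

Lemma pbwMvar m f : pbw m.+1 f -> pbw m.+1 (f * 'x_m).
Proof.
case=> p pP ->; exists (p * 'X); last by rewrite hornerMX.
by move=> k; rewrite coefMX; case: ifP => _; [apply: pbw0 | apply: pP].
Qed.

Lemma pbw_linear m (h : KX) f :
    (forall k g, pbw m g -> pbw m.+1 (g * 'x_m ^+ k * h)) ->
  pbw m.+1 f -> pbw m.+1 (f * h).
Proof.
move=> mh [p pP ->]; rewrite horner_coef mulr_suml.
by elim/big_ind: _ => [|g1 g2|k _]; [apply: pbw0|apply: pbwD|apply/mh/pP].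
Qed.

(** A commutator c moves to the left past x_m by x_m c = c x_m - [c, x_m],
    where [c, x_m] is again a commutator of variables, to be moved past fewer
    factors x_m. *)
Lemma pbwMlcomm m f w : (1 < size w)%N -> pbw m f -> pbw m (f * lcomm K w).
Proof.
elim: m f w => [|m IHm] f w w2 /=.
  case=> s s_comm ->; exists [seq (t.1, rcons t.2 w) | t <- s].
    rewrite all_map; apply: sub_all s_comm => t /=.
    by rewrite /is_comm_mon all_rcons w2.
  rewrite /lin_comb big_map mulr_suml; apply: eq_bigr => t _.
  by rewrite /comm_mon big_rcons -scalerAl.
apply: pbw_linear => k; elim: k w w2 => [|k IHk] w w2 g mg.
  by rewrite expr0 mulr1; apply/pbwS/IHm.
have w_neq0: w != [::] by case: (w) w2.
have ->: g * 'x_m ^+ k.+1 * lcomm K w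
    = g * 'x_m ^+ k * lcomm K w * 'x_m - g * 'x_m ^+ k * lcomm K (rcons w m).
  by rewrite (lcomm_rcons _ _ w_neq0) exprSr !mulrA -mulr_swap.
apply: pbwD; first exact/pbwMvar/IHk.
by apply/pbwN/IHk; rewrite // size_rcons ltnW.
Qed.

(** The same argument, the first step of which turns a variable into the
    commutator [x_j, x_m]. *)
Lemma pbwMfvar m f j : (j < m)%N -> pbw m f -> pbw m (f * 'x_j).
Proof.
elim: m f => // m IHm f; rewrite ltnS leq_eqVlt => /orP[/eqP-> | ltjm].
  exact: pbwMvar.
apply: pbw_linear; elim=> [|k IHk] g mg.
  by rewrite expr0 mulr1; apply/pbwS/IHm.
have ->: g * 'x_m ^+ k.+1 * 'x_j
    = g * 'x_m ^+ k * 'x_j * 'x_m - g * 'x_m ^+ k * lcomm K [:: j; m].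
  by rewrite (lcomm_rcons _ m (isT : [:: j] != [::])) exprSr !mulrA -mulr_swap.
apply: pbwD; first by apply/pbwMvar/IHk.
apply: pbwN.
apply: pbwMlcomm => //; elim: k {IHk} => [|k IHk].
  by rewrite mulr1; apply: pbwS.
by rewrite exprSr mulrA; apply: pbwMvar.
Qed.

Lemma pbw_total f : exists m, pbw m f.
Proof.
elim/freealg_ind: f => [c|f g [m1 mf] [m2 mg]|f i [m mf]].
- by exists 0%N; apply: pbw_const.
- exists (maxn m1 m2); apply: pbwD; [move: mf|move: mg]; apply: pbw_mono.
    exact: leq_maxl.
  exact: leq_maxr.
exists (maxn m i.+1); apply: pbwMfvar; first exact: leq_maxr.
exact: pbw_mono (leq_maxl _ _) mf.
Qed.

Lemma shift_horner i j (p : {poly KX}) :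
  (forall k, shift i p`_k = p`_k) -> shift i p.['x_j] = p.['x_j + (j == i)%:R].
Proof.
move=> pP; rewrite -horner_map /= shift_fvar; congr _.[_].
by apply/polyP => k; rewrite coef_map /= pP.
Qed.

Lemma shift_pbw m i f : (m <= i)%N -> pbw m f -> shift i f = f.
Proof.
elim: m f => [|m IHm] f lemi; first exact: shift_proper.
case=> p pP ->; rewrite shift_horner; last first.
  by move=> k; exact: IHm (ltnW lemi) (pP k).
by rewrite ltn_eqF // addr0.
Qed.

End OrderedMonomials.

(** * Coefficients of an identity are identities *)

Section Elimination.
Context (K : fieldType).
Local Notation KX := (freealg K nat).
Local Notation "''x_' i" := (fvar K i%N : KX)
  (at level 8, i at level 2, format "''x_' i").
Hypothesis charK0 : [pchar K] =i pred0.

(** The difference p(x_m + 1) - p(x_m) is again in V.  By Taylor's formula it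
    is the value at x_m of a polynomial of smaller degree, with leading
    coefficient d + 1 times that of p if p has degree d + 1. *)
Lemma Tideal_top_coef (V : KX -> Prop) m d (p : {poly KX}) :
    is_Tideal V -> (forall k, shift m p`_k = p`_k) -> (size p <= d.+1)%N ->
  V p.['x_m] -> V p`_d.
Proof.
case=> VI VT; elim: d p => [|d IHd] p pP size_p Vp.
  by rewrite (size1_polyC size_p) hornerC in Vp.
pose q := \sum_(i < d.+1) p^`N(i.+1).
have qE k : q`_k = \sum_(i < d.+1) p`_(i.+1 + k) *+ 'C(i.+1 + k, i.+1).
  by rewrite coef_sum; apply: eq_bigr => i _; rewrite coef_nderivn.
have q_d : q`_d = p`_d.+1 *+ d.+1.
  rewrite qE big_ord_recl big1 ?addr0 ?add1n ?bin1 // => i _.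
  rewrite nth_default ?mul0rn //; apply: leq_trans size_p _.
  by rewrite lift0 !addSn !ltnS leq_addl.
suff: V q`_d.
  rewrite q_d -scaler_nat => /(idealZ (d.+1%:R)^-1 VI).
  by rewrite scalerK // ((pcharf0P K).1 charK0).
apply: IHd => [k||].
- rewrite qE raddf_sum; apply: eq_bigr => i _.
  by rewrite raddfMn /= pP.
- apply/leq_sizeP => k ltdk; rewrite qE big1 // => i _.
  rewrite nth_default ?mul0rn //; apply: leq_trans size_p _.
  by rewrite addSn ltnS (leq_trans ltdk) // leq_addl.
suff -> : q.['x_m] = shift m p.['x_m] - p.['x_m].
  by apply: (idealD VI); [apply: (VT (shift m)) | apply: idealN].
rewrite (shift_horner _ pP) eqxx (nderiv_taylor_wide (commr1 _) size_p).
rewrite big_ord_recl nderivn0 expr0 mulr1 addrC addKr /q horner_sum.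
by apply: eq_bigr => i _; rewrite expr1n mulr1.
Qed.

(** The top coefficient in the last variable is in V, hence in J by induction
    on the number of variables, and subtracting its term lowers the degree
    without leaving V. *)
Lemma Tideal_elimination (V J : KX -> Prop) :
    is_Tideal V -> is_Tideal J -> (forall f, J f -> V f) ->
    (forall f, is_proper f -> V f -> J f) ->
  forall f, V f -> J f.
Proof.
move=> VT [JI _] JV properJ f Vf; have [m mf] := pbw_total f.
elim: m f mf Vf => [|m IHm] f; first exact: properJ.
case=> p pP ->.
have: forall k, pbw m p`_k by [].
elim: (size p) {-2}p (leqnn (size p)) => {p pP f} [|d IHd] p size_p pP Vp.
  move: size_p; rewrite leqn0 size_poly_eq0 => /eqP ->.
  by rewrite horner0; apply: ideal0.
have Jd : J p`_d.
  apply: IHm (pP d) _; apply: Tideal_top_coef size_p Vp => // k.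
  exact: shift_pbw (leqnn m) (pP k).
have pE : p = (p - (p`_d)%:P * 'X^d) + (p`_d)%:P * 'X^d by rewrite subrK.
have Jtop : J ((p`_d)%:P * 'X^d).['x_m].
  by rewrite hornerCM hornerXn; apply: (Defs.idealMr JI).
rewrite pE hornerD; apply: (idealD JI) => //; apply: IHd.
- apply/leq_sizeP => k ledk; rewrite coefB coefCM coefXn.
  move: ledk; rewrite leq_eqVlt => /orP[/eqP <-|ltdk].
    by rewrite eqxx mulr1 subrr.
  by rewrite gtn_eqF // mulr0 subr0 nth_default // (leq_trans size_p).
- move=> k; rewrite coefB coefCM coefXn.
  apply: pbwD => //; apply: pbwN; case: eqP => _; first by rewrite mulr1.
  by rewrite mulr0; apply: pbw0.
rewrite hornerD hornerN; apply: (idealD VT.1) => //.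
by apply: (idealN VT.1); apply: JV.
Qed.

End Elimination.

(** * Proper identities *)

Section ProperIdentities.
Context (K : fieldType) (n k : nat).
Local Notation KX := (freealg K nat).
Local Notation "''x_' i" := (fvar K i%N : KX)
  (at level 8, i at level 2, format "''x_' i").
Lemma lcomm_brk w : (1 < size w)%N -> exists f g : KX, lcomm K w = {[f, g]}.
Proof.
case/lastP: w => // w j; rewrite size_rcons ltnS => w1.
by exists (lcomm K w), 'x_j; rewrite lcomm_rcons // -size_eq0 -lt0n.
Qed.

Lemma lcomm3_brk w : size w = 3 -> exists f g h : KX, lcomm K w = {[f, g, h]}.
Proof.
by case: w => [|i [|j [|l []]]] //= _; exists 'x_i, 'x_j, 'x_l; rewrite !commE.
Qed.

Lemma lcomm4_lncomm w : (3 < size w)%N ->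
  exists (f g h l : KX) s, lcomm K w = lncomm (lncomm f [:: g; h; l]) s.
Proof.
case: w => [|i [|j [|l [|m w]]]] //= _.
by exists 'x_i, 'x_j, 'x_l, 'x_m, [seq 'x_j | j <- w].
Qed.

Hypothesis charK0 : [pchar K] =i pred0.
Hypothesis n4 : (4 <= n)%N.
Hypothesis kn : (k <= n./2.+1)%N.
Context (J : KX -> Prop) (JT : is_Tideal J).
Hypothesis J4 : J (lncomm 'x_0 [:: 'x_1; 'x_2; 'x_3]).
Hypothesis Jk : J (comm_prod K k).
Let JI : is_ideal J := JT.1.

(** A factor of length at least 4 is in I_4, and so is a factor of length 3
    next to any other factor, which exists because the degree exceeds 4.  If
    all factors have length 2, there are more than n/2 of them. *)
Lemma comm_mon_long L : is_comm_mon L -> (n < size (flatten L))%N ->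
  J (comm_mon K L).
Proof.
move=> L_comm L_long.
have [/hasP[w wL w4]|/hasPn L3] := boolP (has (fun w => 3 < size w)%N L).
  case/splitPr: wL => L1 L2; rewrite comm_mon_cat comm_mon_cons.
  apply: (idealMl JI); apply: (Defs.idealMr JI).
  have [f [g [h [l [u ->]]]]] := lcomm4_lncomm w4.
  exact: (Tideal_lncomm JT _ (Tideal_lncomm4 JT J4 _ _ _ _)).
have [/hasP[w wL /eqP w3]|/hasPn L2] := boolP (has (fun w => size w == 3) L).
  case/splitPr: wL L_comm L_long {L3} => L1 L2.
  have [f [g [h w_brk]]] := lcomm3_brk w3.
  rewrite comm_mon_cat comm_mon_cons w_brk {w_brk}.
  case: L2 => [|w2 L2]; last first.
    rewrite /is_comm_mon all_cat /= => /and4P[_ _ /lcomm_brk[u [v w2_brk]] _] _.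
    rewrite comm_mon_cons w2_brk [{[f, g, h]} * _]mulrA.
    apply: (idealMl JI); apply: (Defs.idealMr JI).
    exact: Tideal_brk3_brk2.
  case/lastP: L1 => [|L1 w1].
    by rewrite /= cats0 w3 => _ /(leq_trans n4).
  rewrite /is_comm_mon all_cat all_rcons.
  move=> /andP[/andP[/lcomm_brk[u [v w1_brk]] _] _] _.
  rewrite comm_mon_rcons w1_brk.
  exact: (ideal_mul_inner _ _ JI (Tideal_brk2_brk3 JT charK0 J4 f g h u v)).
have size2 w : w \in L -> size w = 2.
  move=> wL; have := allP L_comm w wL; have := L3 w wL; have := L2 w wL.
  by case: (size w) => [|[|[|[]]]].
have -> : comm_mon K L
    = brk_prod [seq ('x_(nth 0%N w 0), 'x_(nth 0%N w 1)) | w <- L].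
  rewrite /comm_mon /brk_prod big_map; apply: eq_big_seq => w /size2.
  by case: w => [|i [|j []]] //= _; rewrite commE.
apply: (Tideal_prod JT Jk); rewrite size_map; apply: leq_trans kn _.
have : size (flatten L) = (size L).*2.
  elim: (L) size2 => //= w L' IHL size2; rewrite size_cat size2 ?mem_head //.
  by rewrite IHL // => v vL'; apply: size2; rewrite inE vL' orbT.
move=> size_L; move: L_long; rewrite size_L; move: (size L) => l.
by rewrite ltn_half_double.
Qed.

(** When all terms involve the same variables U, either these are at most n and
    can be mapped to distinct generators of F_n(N_3), or all terms have degree
    greater than n. *)
Lemma proper_support_in_J (U : seq nat) (s : seq (K * seq (seq nat))) :
    uniq U -> all (fun t => is_comm_mon t.2) s ->
    (forall t, t \in s -> flatten t.2 =i U) ->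
  Id (relfree K n 3) (lin_comb s) -> J (lin_comb s).
Proof.
move=> uniqU s_comm sU Ids; have [size_U|size_U] := leqP (size U) n; last first.
  rewrite /lin_comb big_seq; elim/big_ind: _ => [|f g|t ts].
  - exact: ideal0.
  - exact: (idealD JI).
  apply: (idealZ _ JI); apply: comm_mon_long; first exact: (allP s_comm).
  apply: leq_trans size_U _; apply: uniq_leq_size uniqU _ => i.
  by rewrite sU.
pose b i : freealg K 'I_n :=
  if insub (index i U) is Some o then fvar K o else 0.
have := Ids (fun i => relfree_proj 2 (b i)).
(* b renames the variables of U as x_0, x_1, ... and kills the others; the
   substitution of the entries of U renames them back. *)
rewrite -(feval_comp (@relfree_proj K n 2)) => /relfree_proj_eq0.
move=> /(comm_ideal_sub JT J4) /(Tideal_feval JT (fun j => 'x_(nth 0%N U j))).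
rewrite !feval_comp feval_lin_comb // => t ts i; rewrite sU // => iU.
have ltiU : (index i U < n)%N by apply: leq_trans size_U; rewrite index_mem.
by rewrite /b insubT /= /free_incl !feval_fvar nth_index.
Qed.

(** The variables in U occur in every term, those in V may or may not.  For i in
    V, substituting 0 for x_i keeps the terms without x_i, so these form an
    identity, and so do the remaining ones. *)
Lemma proper_identity_split (V U : seq nat) (s : seq (K * seq (seq nat))) :
    uniq U -> all (fun t => is_comm_mon t.2) s ->
    (forall t, t \in s -> {subset U <= flatten t.2}) ->
    (forall t, t \in s -> {subset flatten t.2 <= V ++ U}) ->
  Id (relfree K n 3) (lin_comb s) -> J (lin_comb s).
Proof.
elim: V U s => [|i V IHV] U s uniqU s_comm sU sV Ids.
  apply: (proper_support_in_J uniqU) => // t ts j.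
  by apply/idP/idP; [apply: sV | apply: sU].
have [iU|iU] := boolP (i \in U).
  apply: IHV uniqU s_comm sU _ Ids => t ts j /(sV t ts).
  by rewrite /= inE => /orP[/eqP->|//]; rewrite mem_cat iU orbT.
pose s1 := [seq t <- s | i \in flatten t.2].
pose s0 := [seq t <- s | i \notin flatten t.2].
have s10 : lin_comb s = lin_comb s1 + lin_comb s0.
  by rewrite /lin_comb (bigID (fun t => i \in flatten t.2)) /= !big_filter.
have kill_s : kill i (lin_comb s) = lin_comb s0.
  rewrite /lin_comb linear_sum big_filter [RHS]big_mkcond.
  apply: eq_bigr => t _.
  by rewrite linearZ /= kill_comm_mon; case: ifP => _ //; rewrite scaler0.
have [IdI IdT] := Id_Tideal (relfree K n 3).
have Ids0 : Id (relfree K n 3) (lin_comb s0).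
  by rewrite -kill_s; apply: (IdT (kill i)).
have Ids1 : Id (relfree K n 3) (lin_comb s1).
  rewrite -[lin_comb s1](addrK (lin_comb s0)) -s10.
  by apply: (idealD IdI) => //; apply: (idealN IdI).
rewrite s10; apply: (idealD JI).
  apply: (IHV (i :: U)) => //=.
  - by rewrite iU.
  - by rewrite all_filter; apply: sub_all s_comm => t /= ->; rewrite implybT.
  - move=> t; rewrite mem_filter => /andP[it ts] j.
    by rewrite inE => /orP[/eqP-> //|]; apply: sU.
  - move=> t; rewrite mem_filter => /andP[it ts] j /(sV t ts).
    by rewrite /= !(inE, mem_cat) => /or3P[->|->|->]; rewrite ?orbT.
apply: (IHV U) => //.
- by rewrite all_filter; apply: sub_all s_comm => t /= ->; rewrite implybT.
- by move=> t; rewrite mem_filter => /andP[it ts]; apply: sU.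
- move=> t; rewrite mem_filter => /andP[it ts] j jt; have := sV t ts j jt.
  by rewrite /= inE => /orP[/eqP ji|//]; rewrite -ji jt in it.
Qed.

Lemma proper_identity f : is_proper f -> Id (relfree K n 3) f -> J f.
Proof.
case=> s s_comm ->.
pose V := flatten [seq flatten t.2 | t <- s].
apply: (@proper_identity_split V [::]) => // t ts i it.
by rewrite cats0; apply/flatten_mapP; exists t.
Qed.

End ProperIdentities.

Lemma Id_relfree_N3 (K : fieldType) (n k : nat) f :
  [pchar K] =i pred0 -> (4 <= n)%N -> k = n./2.+1 ->
  Id (relfree K n 3) f <-> Tideal_gen (@N3_gens K k) f.
Proof.
move=> charK0 n4 kE; have genT := Tideal_gen_Tideal (@N3_gens K k).
have genS g : N3_gens k g -> Tideal_gen (@N3_gens K k) g.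
  by move=> Sg J _; apply.
have sub_Id g : Tideal_gen (@N3_gens K k) g -> Id (relfree K n 3) g.
  apply: Tideal_gen_Id => //; rewrite kE; first exact: (half_leq n4).
  by rewrite doubleS -{1}[n]odd_double_half; case: (odd n); rewrite ?ltnS.
split; last exact: sub_Id.
apply: (Tideal_elimination charK0 (Id_Tideal _) genT sub_Id) => {}f.
apply: (@proper_identity K n k charK0 n4 _ _ genT); first by rewrite kE.
- by apply: genS; left.
- by apply: genS; right.
Qed.

Theorem theorem3p5 (K : fieldType) (charK0 : [pchar K] =i pred0) (n : nat) :
  let x (i : nat) : freealg K nat := fvar K i in
  let x1x2x3x4 : freealg K nat := lncomm (x 0%N) [:: x 1%N; x 2%N; x 3%N] in
  ((4 <= n)%N -> ~~ odd n ->
     forall f : freealg K nat,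
       Id (relfree K n 3) f <->
       Tideal_gen (fun g => g = x1x2x3x4 \/ g = comm_prod K n.+2./2) f)
  /\
  ((5 <= n)%N -> odd n ->
     forall f : freealg K nat,
       Id (relfree K n 3) f <->
       Tideal_gen (fun g => g = x1x2x3x4 \/ g = comm_prod K n.+1./2) f).
Proof.
split=> n_ge odd_n f; apply: Id_relfree_N3 => //; first exact: ltnW.
by rewrite -uphalfE uphalf_half odd_n.
Qed.
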